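(* Consider two source trajectories $b$ and $\tilde b$ with corresponding observations $\phi$ and $\tilde\phi$ at points $\mathbf{x}_1,\dots,\mathbf{x}_6\in\Gamma$ such that the $3\times3$ matrix $X$ with rows $\mathbf{x}_2-\mathbf{x}_1$, $\mathbf{x}_4-\mathbf{x}_3$, $\mathbf{x}_6-\mathbf{x}_5$ is invertible. Then $$\|b-\tilde b\|_{L^\infty(0,T)}\le C\sup_{i=1,3,5}\Big(\|\tilde\phi(\mathbf{x}_i,\cdot)-\phi(\mathbf{x}_i,\cdot)\|_{L^\infty(0,T_{\mathrm{obs}})}+\|\tilde\phi(\mathbf{x}_{i+1},\cdot)-\phi(\mathbf{x}_{i+1},\cdot)\|_{L^\infty(0,T_{\mathrm{obs}})}\Big)$$ for some constant $C=C(\Omega,\lambda,T,c,c_0,D)>0$.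
   Context: Let $c>0$ be the wave speed, $\lambda>0$ the known source intensity, and $c_0<c$ a constant. $D\subset\mathbb{R}^3$ is a bounded domain, and $\Omega\subset\mathbb{R}^3$ is a smooth bounded domain with $\overline{D}\subset\Omega$ and boundary $\Gamma$. $|\cdot|$ and $\cdot$ denote the Euclidean norm and scalar product in $\mathbb{R}^3$. Put $T_0=\sup_{\mathbf{x}\in\Gamma,\,\mathbf{y}\in D}|\mathbf{x}-\mathbf{y}|/c$, let $T>T_0$ be a fixed time, and let $T_{\mathrm{obs}}=T+T_0$; observations are assumed to continue until the time $T_{\mathrm{obs}}$. A source trajectory is a function $b\in C^2([0,T];\mathbb{R}^3)$ confined within $D$ and subsonic, that is, $\|b'\|_{C([0,T])}\le c_0<c$. The field generated by the source is the solution $\phi$ of $\frac{1}{c^2}\phi_{tt}-\Delta\phi=\lambda\,\delta(\mathbf{x}-b(t))$ in $\mathbb{R}^3\times(0,T)$ with $\phi(\mathbf{x},0)=\phi_t(\mathbf{x},0)=0$ in $\mathbb{R}^3$. It is given by $$\phi(\mathbf{x},t)=\frac{\lambda}{4\pi}\,\frac{Y(r)}{|\mathbf{x}-b(r)|\,h(\mathbf{x},r)},\qquad h(\mathbf{x},r)=1-\frac{b'(r)\cdot(\mathbf{x}-b(r))}{c\,|\mathbf{x}-b(r)|},$$ where $Y$ is the Heaviside function and, for each fixed $(\mathbf{x},t)$, $r=r(\mathbf{x},t)$ is the unique solution of $r=t-|\mathbf{x}-b(r)|/c$. The observation corresponding to $b$ consists of the values of $\phi$ at the points $\mathbf{x}_i$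 over the time interval $(0,T_{\mathrm{obs}})$. The field $\tilde\phi$ is defined in the same way from the trajectory $\tilde b$, with the same $\lambda$ and $c$.
   Formalization: The constant C is allowed to depend also on the invertible matrix X: with C depending only on Ω, λ, T, c, c_0, D the estimate fails (mirror-image trajectories with observation points tending to the mirror plane). *)

(* Defs.v *)
From HB Require Import structures.
From mathcomp Require Export all_boot all_order all_algebra.
From mathcomp Require Export all_classical all_reals all_analysis.
Export Order.TTheory GRing.Theory Num.Theory.
Export numFieldNormedType.Exports.

Set Implicit Arguments.
Unset Strict Implicit.
Unset Printing Implicit Defensive.

Local Open Scope classical_set_scope.
Local Open Scope ring_scope.

(* The canonical norm of 'rV[R]_3 in the library is the max norm; it is used
   here only through the topology and the bounded sets it induces.  Lengths
   are measured with [enorm]. *)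
Definition dotp (R : realType) (u v : 'rV[R]_3) : R :=
  \sum_(i < 3) u ord0 i * v ord0 i.

Definition enorm (R : realType) (u : 'rV[R]_3) : R := Num.sqrt (dotp u u).

Definition domain (R : realType) (A : set 'rV[R]_3) : Prop :=
  [/\ open A, connected A & A !=set0].

Definition boundary (R : realType) (A : set 'rV[R]_3) : set 'rV[R]_3 :=
  closure A `\` interior A.

(* [partials [:: i1; ...; ik] f] is the iterated partial derivative
   d_i1 ... d_ik f. *)
Definition partials (R : realType) (s : seq 'I_3) (f : 'rV[R]_3 -> R) :
    'rV[R]_3 -> R :=
  foldr (fun i (g : 'rV[R]_3 -> R) =>
           fun x => 'D_(delta_mx ord0 i : 'rV[R]_3) g x) f s.

(* C^oo on an open set U *)
Definition smooth_on (R : realType) (U : set 'rV[R]_3) (f : 'rV[R]_3 -> R) :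
    Prop :=
  forall (s : seq 'I_3) (x : 'rV[R]_3), U x ->
    {for x, continuous (partials s f)} /\
    forall i : 'I_3, derivable (partials s f) x (delta_mx ord0 i : 'rV[R]_3).

(* A has a C^oo boundary: near each boundary point, A is the sublevel set
   {g < 0} of a C^oo function with nonvanishing gradient at that point. *)
Definition smooth_boundary (R : realType) (A : set 'rV[R]_3) : Prop :=
  forall p : 'rV[R]_3, boundary A p ->
    exists (U : set 'rV[R]_3) (g : 'rV[R]_3 -> R),
      [/\ open U, U p, smooth_on U g,
          exists i : 'I_3, partials [:: i] g p != 0
        & forall x : 'rV[R]_3, U x -> (A x <-> g x < 0)].

(* Derivatives relative to a set A of times; at the endpoints of an interval
   these are the one-sided derivatives. *)
Definition diffquot (R : realType) (f : R -> 'rV[R]_3) (t s : R) : 'rV[R]_3 :=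
  (s - t)^-1 *: (f s - f t).

Definition derivable_within (R : realType) (A : set R) (f : R -> 'rV[R]_3) :
    Prop :=
  forall t : R, A t -> cvg (diffquot f t s @[s --> within A t^']).

Definition derive_within (R : realType) (A : set R) (f : R -> 'rV[R]_3)
    (t : R) : 'rV[R]_3 :=
  lim (diffquot f t s @[s --> within A t^']).

Definition C2_on (R : realType) (A : set R) (f : R -> 'rV[R]_3) : Prop :=
  [/\ derivable_within A f,
      derivable_within A (derive_within A f)
    & {within A, continuous (derive_within A (derive_within A f))}].

Definition velocity (R : realType) (T : R) (b : R -> 'rV[R]_3) :
    R -> 'rV[R]_3 :=
  derive_within `[0, T] b.

(* Only the values of b on [0, T] matter, here and below. *)
Definition trajectory (R : realType) (c0 T : R) (D : set 'rV[R]_3)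
    (b : R -> 'rV[R]_3) : Prop :=
  [/\ C2_on `[0, T] b,
      forall t : R, 0 <= t <= T -> D (b t)
    & forall t : R, 0 <= t <= T -> enorm (velocity T b t) <= c0].

Definition heaviside (R : realType) (r : R) : R := if 0 <= r then 1 else 0.

(* b is not defined at negative times.  A negative retarded time r only means
   that the wave front has not yet reached x, in which case Y(r) = 0 and the
   field vanishes; holding b at b(0) for r < 0 detects exactly that case. *)
Definition past_ext (R : realType) (b : R -> 'rV[R]_3) (r : R) : 'rV[R]_3 :=
  b (Num.max r 0).

Definition retarded_time (R : realType) (c : R) (b : R -> 'rV[R]_3)
    (x : 'rV[R]_3) (t r : R) : Prop :=
  r = t - enorm (x - past_ext b r) / c.

Definition doppler (R : realType) (c T : R) (b : R -> 'rV[R]_3)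
    (x : 'rV[R]_3) (r : R) : R :=
  1 - dotp (velocity T b r) (x - past_ext b r)
      / (c * enorm (x - past_ext b r)).

(* phi is a field generated by b.  Through the retarded time, b determines
   phi(x, t) for t <= T + |x - b(T)| / c.  Afterwards phi(x, t) depends on what
   the source does after time T, about which b says nothing, so no condition
   is imposed there. *)
Definition generated_field (R : realType) (c lambda T : R)
    (b : R -> 'rV[R]_3) (phi : 'rV[R]_3 -> R -> R) : Prop :=
  forall (x : 'rV[R]_3) (t r : R),
    r <= T -> retarded_time c b x t r -> x != past_ext b r ->
    phi x t = lambda / (4 * pi)
              * (heaviside r / (enorm (x - past_ext b r) * doppler c T b x r)).

(* T_0 = sup_{x in Gamma, y in D} |x - y| / c with Gamma = boundary Omega *)
Definition crossing_time (R : realType) (c : R) (Omega D : set 'rV[R]_3) : R :=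
  sup [set z : R | exists x y : 'rV[R]_3,
         [/\ boundary Omega x, D y & z = enorm (x - y) / c]].

(* L^oo(0, S) norm, with value +oo when f is not essentially bounded *)
Definition Linfty (R : realType) (S : R) (f : R -> R) : \bar R :=
  'N[@lebesgue_measure R]_(+oo%E) [EFin \o (f \_ `]0, S[)].

(* The observation points are x 1, ..., x 6; rows x2 - x1, x4 - x3, x6 - x5. *)
Definition obs_matrix (R : realType) (x : nat -> 'rV[R]_3) : 'M[R]_3 :=
  \matrix_(k < 3) (x (2 * k + 2)%N - x (2 * k + 1)%N).

(* Main.v *)
From mathcomp Require Import ess_sup_inf ring lra.
Require Import Defs.

Set Implicit Arguments.
Unset Strict Implicit.
Unset Printing Implicit Defensive.

Local Open Scope classical_set_scope.
Local Open Scope ring_scope.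

(** The distances from the source to three pairs of detectors determine its
position by linear algebra, so the point is to recover one such distance,
stably, from the field recorded by one detector.

Fix a detector x and put u(r) = |x - b(r)| / c, the travel time of the signal
emitted at time r.  As the source is subsonic, the arrival time r + u(r) is a
strictly increasing function of r; let e(t) be its inverse, the emission time
of what is received at time t.  Since e'(t) = 1 / (1 + u'(e(t))) is the inverse
Doppler factor, the explicit formula for the field says that, with
k = lambda / (4 pi c),

   phi(t) = k e'(t) / (t - e(t)),

that is, the delay a(t) = t - e(t) solves the linear equation
a' = 1 - (phi / k) a.  Two delays a and a~ that start from the same value thus
satisfy (a - a~)' = - (phi~ / k) (a - a~) + ((phi~ - phi) / k) a.  As phi~ is
nonnegative, the first term only damps the difference, and a <= T0 gives
|a - a~| <= (T0 / k) (t - t0) sup |phi~ - phi| up to the first of the two last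
arrivals ([emission_time_comparison]).  Going back from arrival to emission
times costs the factor 1 + c0 / c, because u is (c0 / c)-Lipschitz.

If the two wave fronts reach x at different times, one field is still zero
while the other one is already at least k / (T0 (1 + c0 / c)); the misfit is
then bounded below ([front_misfit]), and the trivial bound |u - u~| <= T0
suffices.  Both cases give the same estimate ([delay_stability]).

Finally |x - b|^2 - |y - b|^2 = |x|^2 - |y|^2 + 2 (y - x) . b, so the
distances to a pair of detectors control the component of b - b~ along y - x
([row_observation_le]), and three independent components control b - b~
([enorm_le_inverse]). *)

(** * A comparison lemma and almost-everywhere bounds *)

(** The bound on w' is only assumed where w > 0.  From the last time before t at
which w <= 0 up to t, this holds, and the mean value theorem applies. *)
Lemma comparison_linear (R : realType) (w w' : R -> R) (a b L : R) :
  0 <= L -> w a <= 0 -> continuous w ->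
  (forall t, a < t < b -> is_derive t 1 w (w' t)) ->
  (forall t, a < t < b -> 0 < w t -> w' t <= L) ->
  forall t, a <= t <= b -> w t <= L * (t - a).
Proof.
move=> L0 wa0 wC wD w'L t /andP[at_ tb].
have [wt0|wt0] := leP (w t) 0.
  by rewrite (le_trans wt0)// mulr_ge0// subr_ge0.
pose S := [set y | a <= y <= t /\ w y <= 0].
have Sa : S a by split => //; rewrite lexx.
have Sub : ubound S t by move=> y [/andP[]].
have Ssup : has_sup S by split; [exists a|exists t].
pose s := sup S.
have as_ : a <= s by exact: sup_upper_bound.
have st : s <= t by apply: ge_sup => //; exists a.
have ws0 : w s <= 0.
  rewrite leNgt; apply/negP => ws0.
  have /nbhs_ballP[e /= e0 we] : \forall y \near s, 0 < w y.
    exact: (@cvgr_gt _ _ (nbhs s) _ _ _ (wC s) 0 ws0).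
  have [y Sy sy] := sup_adherent e0 Ssup.
  have ys : y <= s by exact: sup_upper_bound.
  have : 0 < w y.
    by apply: we; rewrite /ball/= ger0_norm ?subr_ge0//; rewrite -/s in sy; lra.
  by case: Sy => _; lra.
have {}st : s < t.
  by rewrite lt_neqAle st andbT; apply/eqP => E; move: ws0; rewrite E; lra.
have wpos y : s < y -> y <= t -> 0 < w y.
  move=> sy yt; rewrite ltNge; apply/negP => wy.
  suff : y <= s by lra.
  by apply: sup_upper_bound => //; split => //; rewrite yt andbT; lra.
have [c /itvP cst E] := MVT st (fun y (h : y \in `]s, t[) =>
  wD y ltac:(move: h; rewrite in_itv/= => /andP[]; lra))
  (continuous_subspaceT wC).
have w'c : w' c <= L.
  apply: w'L; last by apply: wpos; rewrite ?cst// ltW ?cst.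
  by rewrite (le_lt_trans as_) ?cst//= (lt_le_trans _ tb) ?cst.
have : w' c * (t - s) <= L * (t - s) by rewrite ler_wpM2r// subr_ge0 ltW.
have : L * (t - s) <= L * (t - a) by rewrite ler_wpM2l//; lra.
by rewrite -E; lra.
Qed.

Lemma ae_lebesgueS (R : realType) (P Q : R -> Prop) :
  (forall x, P x -> Q x) ->
  {ae @lebesgue_measure R, forall x, P x} ->
  {ae @lebesgue_measure R, forall x, Q x}.
Proof.
move=> PQ; have ff := @ae_filter_ringOfSetsType _ _ _ (@lebesgue_measure R).
exact: (@filterS _ _ ff).
Qed.

(** Almost-everywhere statements are used through this density property: a
nonempty open interval is not negligible. *)
Lemma ae_exists_itv (R : realType) (P : R -> Prop) (a b : R) : a < b ->
  {ae @lebesgue_measure R, forall x, P x} -> exists2 x, a < x < b & P x.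
Proof.
move=> ab [N [mN N0 PN]]; apply: contrapT => h.
have abN : `]a, b[ `<=` N.
  move=> x /=; rewrite in_itv/= => xab; apply: PN => Px.
  by apply: h; exists x.
have : (lebesgue_measure (`]a, b[ : set R) <= lebesgue_measure N)%E.
  by apply: le_measure; rewrite ?inE//; exact: measurable_itv.
by rewrite N0 lebesgue_measure_itv/= lte_fin ab lee_fin; lra.
Qed.

Lemma ae_le_continuous (R : realType) (f : R -> R) (a b m : R) :
  {ae @lebesgue_measure R, forall x, a < x < b -> f x <= m} ->
  (forall x, a < x < b -> {for x, continuous f}) ->
  forall x, a < x < b -> f x <= m.
Proof.
move=> fm fC x xab; rewrite leNgt; apply/negP => mfx.
have /nbhs_ballP[e /= e0 fe] : \forall y \near x, m < f y.
  exact: (@cvgr_gt _ _ (nbhs x) _ _ _ (fC x xab) m mfx).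
move: xab => /andP[ax xb].
have xm : x < Num.min (x + e) b by rewrite lt_min xb ltrDl e0.
have [y /andP[xy ym] fy] := ae_exists_itv xm fm.
move: ym; rewrite lt_min => /andP[ye yb].
have : f y <= m by apply: fy; rewrite yb (lt_trans ax).
apply/negP; rewrite -ltNge; apply: fe.
by rewrite /ball/= ler0_norm ?subr_le0 ?(ltW xy)//; lra.
Qed.

(** * Emission times *)

(** The travel times u are defined for all r in R, so that the arrival time
r + u(r) becomes a bijection of the real line whenever g < 1; the emissions
that count are those with 0 < r < T. *)
Definition travel_delay (R : realType) (g T0 T : R) (u u' : R -> R) : Prop :=
  [/\ forall r s, `|u r - u s| <= g * `|r - s|,
      forall r, 0 < u r <= T0,
      forall r, 0 < r < T -> is_derive r 1 u (u' r) /\ `|u' r| <= g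
    & forall r, 0 < r < T -> {for r, continuous u'}].

Definition emission_time (R : realType) (u : R -> R) (t : R) : R :=
  xget 0 [set r | r + u r = t].

Section emission_time.
Context (R : realType) (g T0 T : R) (u u' : R -> R).
Hypotheses (g_lt1 : g < 1) (uP : travel_delay g T0 T u u').
Local Notation e := (emission_time u).

Let u_lip r s : `|u r - u s| <= g * `|r - s|. Proof. by case: uP. Qed.
Let u_bnd r : 0 < u r <= T0. Proof. by case: uP. Qed.

Lemma lip_continuous (f : R -> R) (k : R) :
  (forall r s, `|f r - f s| <= k * `|r - s|) -> continuous f.
Proof.
move=> fk x; apply/cvgrPdist_lt => eps eps0.
near=> y; rewrite (le_lt_trans (fk x y))//.
have k1 : 0 < `|k| + 1 by rewrite ltr_wpDl.
have : `|x - y| < eps / (`|k| + 1).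
  by near: y; apply: cvgr_dist_lt => //; rewrite divr_gt0.
rewrite ltr_pdivlMr// => h; rewrite (le_lt_trans _ h)// mulrC ler_wpM2l//.
by rewrite (le_trans (ler_norm k))// lerDl.
Unshelve. all: by end_near. Qed.

Lemma arrival_mono r s : r <= s -> (1 - g) * (s - r) <= (s + u s) - (r + u r).
Proof.
move=> rs; have := u_lip r s; rewrite distrC (distrC r) (ger0_norm (x := s - r)) ?subr_ge0// ler_norml.
by move=> /andP[]; lra.
Qed.

Lemma arrival_lt r s : (r + u r < s + u s) = (r < s).
Proof.
have g1 : 0 < 1 - g by rewrite subr_gt0.
have [rs|sr] := ltP r s.
  rewrite -subr_gt0 (lt_le_trans _ (arrival_mono (ltW rs)))//.
  by rewrite mulr_gt0// subr_gt0.
apply/negbTE; rewrite -leNgt -subr_ge0 (le_trans _ (arrival_mono sr))//.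
by rewrite mulr_ge0 ?(ltW g1)// subr_ge0.
Qed.

Lemma arrival_inj : injective (fun r => r + u r).
Proof.
move=> r s /= rs; apply/eqP; rewrite eq_le.
by rewrite !leNgt -(arrival_lt r s) -(arrival_lt s r) rs ltxx.
Qed.

(** The arrival time is continuous and increasing; the value t is attained
between t - T0 and t because 0 < u <= T0. *)
Lemma emission_timeK t : e t + u (e t) = t.
Proof.
rewrite /emission_time; case: xgetP => [//|/= H]; exfalso.
have uC : continuous (fun r => r + u r).
  by move=> x; apply: cvgD => //; exact: (lip_continuous u_lip).
have [] := @IVT R (fun r => r + u r) (t - T0) t t.
- by have /andP[] := u_bnd t; lra.
- exact: continuous_subspaceT.
- rewrite ge_min le_max; have /andP[? ?] := u_bnd t.
  have /andP[? ?] := u_bnd (t - T0).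
  by apply/andP; split; apply/orP; [left|right]; lra.
- by move=> r _ /H.
Qed.

Lemma arrivalK r : e (r + u r) = r.
Proof. by apply: arrival_inj => /=; rewrite emission_timeK. Qed.

Lemma delay_at t : u (e t) = t - e t.
Proof. by apply/eqP; rewrite eq_sym subr_eq addrC emission_timeK. Qed.

Lemma emission_time_lt r t : (r < e t) = (r + u r < t).
Proof. by rewrite -[in RHS](emission_timeK t) arrival_lt. Qed.

Lemma emission_time_gt r t : (e t < r) = (t < r + u r).
Proof. by rewrite -[in RHS](emission_timeK t) arrival_lt. Qed.

Lemma emission_time_continuous : continuous e.
Proof.
have g1 : 0 < 1 - g by rewrite subr_gt0.
apply: (@lip_continuous _ (1 - g)^-1) => r s.
wlog : r s / e s <= e r => [H|sr].
  have [/H//|/ltW/H] := leP (e s) (e r).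
  by rewrite distrC => /le_trans; apply; rewrite distrC.
rewrite mulrC ler_pdivlMr// mulrC ger0_norm ?subr_ge0//.
by rewrite (le_trans (arrival_mono sr))// !emission_timeK ler_norm.
Qed.

Lemma emission_time_is_derive t : 0 < e t < T ->
  is_derive t 1 e (1 + u' (e t))^-1.
Proof.
move=> et; have [_ _ /(_ _ et)[uD u'g] _] := uP.
rewrite -[t in is_derive t](emission_timeK t).
apply: (@is_derive_inverse _ (fun r => r + u r)).
- by near=> r; exact: arrivalK.
- near=> r; apply: cvgD => //; exact: (lip_continuous u_lip).
- by rewrite gt_eqF//; move: u'g; rewrite ler_norml => /andP[h _]; move: g_lt1; lra.
Unshelve. all: by end_near. Qed.

End emission_time.

(** * Stability of the travel times *)

(** The field recorded by one detector: it vanishes before the front arrives,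
and afterwards 1 + u' is the Doppler factor.  The two instants at which the
emissions of times 0 and T arrive are negligible and left aside. *)
Definition signal (R : realType) (k T : R) (u u' phi : R -> R) : Prop :=
  (forall r, r < 0 -> phi (r + u r) = 0) /\
  (forall r, 0 < r < T -> phi (r + u r) = k / (u r * (1 + u' r))).

Section stability.
Context (R : realType) (g T0 T k : R).
Hypotheses (g_ge0 : 0 <= g) (g_lt1 : g < 1) (T0_gt0 : 0 < T0) (T0_ltT : T0 < T)
  (k_gt0 : 0 < k).
Local Notation delay := (travel_delay g T0 T).

Lemma doppler_bounds u u' r : delay u u' -> 0 < r < T -> 0 < 1 + u' r <= 1 + g.
Proof.
move=> [_ _ uD _] /uD[_]; rewrite ler_norml => /andP[h1 h2].
by move: g_lt1 h1 h2; lra.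
Qed.

Lemma signal_at u u' phi t : delay u u' -> signal k T u u' phi ->
  0 < emission_time u t < T ->
  phi t = k / ((t - emission_time u t) * (1 + u' (emission_time u t))).
Proof.
move=> du [_ sphi] /sphi.
by rewrite (emission_timeK du) (delay_at du).
Qed.

(** Continuity turns an almost-everywhere bound on the misfit into a bound at
every time, which is what the differential inequality needs. *)
Lemma signal_continuous u u' phi t : delay u u' -> signal k T u u' phi ->
  0 < emission_time u t < T -> {for t, continuous phi}.
Proof.
move=> du su et.
have eC := emission_time_continuous g_lt1 du.
have et_near : \forall s \near t, 0 < emission_time u s < T.
  have /andP[e0 eT] := et.
  near=> s; apply/andP; split; near: s.
    exact: (@cvgr_gt _ _ (nbhs t) _ _ _ (eC t) 0 e0).
  exact: (@cvgr_lt _ _ (nbhs t) _ _ _ (eC t) T eT).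
have phiE : \forall s \near t,
    k / ((s - emission_time u s) * (1 + u' (emission_time u s))) = phi s.
  by near=> s; rewrite (signal_at du su)//; near: s.
rewrite /prop_for /continuous_at -(nbhs_singleton phiE).
apply: cvg_trans (near_eq_cvg phiE) _.
have [_ ub _ u'C] := du.
apply: cvgM; first exact: cvg_cst.
apply: cvgV.
  rewrite mulf_neq0 ?gt_eqF//; last by have /andP[] := doppler_bounds du et.
  by rewrite -(delay_at du); have /andP[] := ub (emission_time u t).
apply: cvgM; first by apply: cvgB => //; exact: eC.
apply: cvgD; first exact: cvg_cst.
apply: (@cvg_comp _ _ _ (emission_time u) u' (nbhs t) (nbhs (emission_time u t))).
  exact: eC.
exact: u'C.
Unshelve. all: by end_near. Qed.

Definition misfit_le (m : R) (phi psi : R -> R) : Prop :=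
  {ae @lebesgue_measure R, forall t, 0 < t < T + T0 -> `|phi t - psi t| <= m}.

Lemma misfit_leC m phi psi : misfit_le m phi psi -> misfit_le m psi phi.
Proof. by apply: ae_lebesgueS => t h /h; rewrite distrC. Qed.

Lemma misfit_ge0 m phi psi : misfit_le m phi psi -> 0 <= m.
Proof.
move=> h; have T1 : 0 < T + T0 by move: T0_gt0 T0_ltT; lra.
have [t tT /(_ tT)] := ae_exists_itv T1 h.
exact: le_trans.
Qed.

(** Between the two front arrivals only one of the fields is nonzero, and it is
at least k / (T0 (1 + g)). *)
Lemma front_misfit u u' v v' phi psi m :
  delay u u' -> delay v v' -> signal k T u u' phi -> signal k T v v' psi ->
  misfit_le m phi psi -> u 0 < v 0 -> k <= m * (T0 * (1 + g)).
Proof.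
move=> du dv su sv mle uv.
have [[_ ub _ _] [_ vb _ _]] := (du, dv).
have [t /andP[ut tv]] := ae_exists_itv uv mle.
have /andP[u0 uT0] := ub 0; have /andP[v0 vT0] := vb 0.
have eu : 0 < emission_time u t < T.
  rewrite (emission_time_lt g_lt1 du) (emission_time_gt g_lt1 du) add0r ut/=.
  have /andP[uT _] := ub T.
  by move: tv vT0 T0_ltT uT; lra.
have ev : emission_time v t < 0.
  by rewrite (emission_time_gt g_lt1 dv) add0r.
have psi0 : psi t = 0.
  by have [/(_ _ ev)] := sv; rewrite (emission_timeK dv).
rewrite psi0 subr0 (signal_at du su eu) -(delay_at du).
have /andP[a0 aT0] := ub (emission_time u t).
have /andP[h0 hg] := doppler_bounds du eu.
set a := u _ in a0 aT0 *; set h := 1 + _ in h0 hg *.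
have ah0 : 0 < a * h by rewrite mulr_gt0.
move=> /(_ ltac:(move: ut tv vT0 u0 T0_ltT T0_gt0; lra)).
rewrite ger0_norm ?divr_ge0 ?(ltW k_gt0) ?(ltW ah0)// ler_pdivrMr// => km.
have m0 := misfit_ge0 mle.
by rewrite (le_trans km)// ler_wpM2l// ler_pM// ltW.
Qed.

(** The difference w of the emission times, which up to sign is that of the
delays, has derivative (psi b - phi a) / k, where a and b are the two delays.
When w > 0 the inequality b < a holds, and psi >= 0 yields
psi b - phi a <= (psi - phi) a <= m T0. *)
Lemma emission_time_comparison u u' v v' phi psi m t1 :
  delay u u' -> delay v v' -> signal k T u u' phi -> signal k T v v' psi ->
  misfit_le m phi psi -> u 0 = v 0 -> t1 <= T + u T -> t1 <= T + v T ->
  forall t, u 0 <= t <= t1 ->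
  emission_time v t - emission_time u t <= m * T0 / k * (t - u 0).
Proof.
move=> du dv su sv mle uv t1u t1v.
have [[_ ub _ _] [_ vb _ _]] := (du, dv).
have m0 := misfit_ge0 mle.
have emitted t : u 0 < t < t1 ->
    0 < emission_time u t < T /\ 0 < emission_time v t < T.
  move=> /andP[ut tt1].
  rewrite (emission_time_lt g_lt1 du) (emission_time_gt g_lt1 du).
  rewrite (emission_time_lt g_lt1 dv) (emission_time_gt g_lt1 dv).
  by rewrite !add0r -uv ut !(lt_le_trans tt1).
have mis t : u 0 < t < t1 -> psi t - phi t <= m.
  move=> tt1; have [eu ev] := emitted _ tt1.
  apply: (@ae_le_continuous _ (psi \- phi) (u 0) t1) => //.
    apply: ae_lebesgueS mle => s h /andP[us st1]; rewrite /= (le_trans (ler_norm _))//.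
    rewrite distrC h//.
    have /andP[u0 _] := ub 0; have /andP[_ uT] := ub T.
    by move: us st1 t1u u0 uT; lra.
  move=> s /emitted[eus evs]; apply: cvgB.
    exact: (signal_continuous dv sv).
  exact: (signal_continuous du su).
apply: (@comparison_linear _ _ (fun t => (1 + v' (emission_time v t))^-1
    - (1 + u' (emission_time u t))^-1)).
- by rewrite divr_ge0 ?mulr_ge0 ?(ltW T0_gt0) ?(ltW k_gt0).
- have E w w' : delay w w' -> emission_time w (w 0) = 0.
    by move=> dw; have := arrivalK g_lt1 dw 0; rewrite add0r.
  by rewrite (E _ _ du) uv (E _ _ dv) subrr.
- move=> t; apply: cvgB.
    exact: (emission_time_continuous g_lt1 dv).
  exact: (emission_time_continuous g_lt1 du).
- move=> t /emitted[eu ev]; apply: is_deriveB.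
    exact: (emission_time_is_derive g_lt1 dv).
  exact: (emission_time_is_derive g_lt1 du).
- move=> t tt1; have [eu ev] := emitted _ tt1; have := mis _ tt1.
  rewrite (signal_at du su eu) (signal_at dv sv ev).
  rewrite ler_pdivlMr// => h we.
  have /andP[a0 aT0] := ub (emission_time u t).
  have /andP[b0 bT0] := vb (emission_time v t).
  have /andP[p0 _] := doppler_bounds du eu.
  have /andP[q0 _] := doppler_bounds dv ev.
  have ba : t - emission_time v t <= t - emission_time u t by move: we; lra.
  rewrite (delay_at du) in a0 aT0; rewrite (delay_at dv) in b0 bT0.
  move: h ba a0 aT0 b0 bT0 p0 q0.
  set a := t - emission_time u t; set b := t - emission_time v t.
  set p := 1 + u' _; set q := 1 + v' _ => h ba a0 aT0 b0 bT0 p0 q0.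
  have kp : p^-1 * k = k / (a * p) * a by field; rewrite ?gt_eqF.
  have kq : q^-1 * k = k / (b * q) * b by field; rewrite ?gt_eqF.
  rewrite mulrBl kp kq.
  have : k / (b * q) * b <= k / (b * q) * a.
    by rewrite ler_wpM2l// divr_ge0 ?mulr_ge0 ?(ltW b0) ?(ltW q0) ?(ltW k_gt0).
  have : (k / (b * q) - k / (a * p)) * a <= m * T0.
    by rewrite (le_trans (ler_wpM2r (ltW a0) h))// ler_wpM2l.
  by lra.
Qed.

(** The comparison is available until the first of the two last arrivals, so
the roles of u and v are chosen for every emission of u to arrive before
then. *)
Lemma delay_stability u u' v v' phi psi m :
  delay u u' -> delay v v' -> signal k T u u' phi -> signal k T v v' psi ->
  misfit_le m phi psi ->
  forall r, 0 <= r <= T ->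
  `|u r - v r| <= (1 + g) * (T0 * (T + T0) / k) * m.
Proof.
move=> du dv su sv mle r rT.
wlog arr : u u' v v' phi psi du dv su sv mle / T + u T <= T + v T => [H|].
  have [uv|/ltW vu] := leP (T + u T) (T + v T).
    exact: (H _ _ _ _ _ _ du dv su sv mle).
  by rewrite distrC; exact: (H _ _ _ _ _ _ dv du sv su (misfit_leC mle)).
have m0 := misfit_ge0 mle.
have [[_ ub _ _] [vl vb _ _]] := (du, dv).
have T00 := ltW T0_gt0; have k0 := ltW k_gt0.
have T_ge0 := le_trans T00 (ltW T0_ltT).
have g1 : 0 <= 1 + g by rewrite addr_ge0.
have /andP[u0 uT0] := ub r; have /andP[v0 vT0] := vb r.
(* Different front arrivals: the misfit is too large for |u - v| <= T0 to fail
   the claim. *)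
have [uv0|uv0] := eqVneq (u 0) (v 0); last first.
  have km : k <= m * (T0 * (1 + g)).
    have [lt|lt|E] := ltgtP (u 0) (v 0).
    - exact: (front_misfit du dv su sv mle).
    - exact: (front_misfit dv du sv su (misfit_leC mle)).
    - by rewrite E eqxx in uv0.
  apply: (@le_trans _ _ T0); first by rewrite ler_norml; apply/andP; split; lra.
  rewrite -(ler_pM2r k_gt0).
  have -> : (1 + g) * (T0 * (T + T0) / k) * m * k
      = T0 * (m * (T0 * (1 + g))) + (1 + g) * T0 * T * m.
    by field; rewrite gt_eqF.
  by rewrite ler_wpDr ?mulr_ge0// ler_wpM2l.
pose t := r + u r.
have /andP[r0 rT'] := rT.
have eut : emission_time u t = r by exact: (arrivalK g_lt1 du).
have tT : t <= T + u T.
  by rewrite leNgt (arrival_lt g_lt1 du) -leNgt.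
have t0 : u 0 <= t.
  by rewrite leNgt -[u 0]add0r (arrival_lt g_lt1 du) -leNgt.
have tin : u 0 <= t <= T + u T by rewrite t0.
have eps : `|emission_time v t - r| <= m * T0 / k * (t - u 0).
  rewrite -eut ler_norml; apply/andP; split; last first.
    exact: (emission_time_comparison du dv su sv mle uv0 (lexx _) arr tin).
  rewrite lerNl opprB uv0.
  rewrite uv0 in tin.
  by apply: (emission_time_comparison dv du sv su (misfit_leC mle) _ arr _ tin).
have {}eps : `|emission_time v t - r| <= m * T0 / k * (T + T0).
  rewrite (le_trans eps)// ler_wpM2l ?divr_ge0 ?mulr_ge0//.
  by have /andP[h _] := ub 0; rewrite /t; move: h r0 rT' uT0; lra.
(* u r and v (e_v t) are the two delays at the arrival time t = r + u r; it
   remains to move v from the emission time e_v t to r. *)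
have -> : u r - v r = (v (emission_time v t) - v r) + (emission_time v t - r).
  by rewrite (delay_at dv) /t; ring.
rewrite (le_trans (ler_normD _ _))//.
rewrite (le_trans (lerD (vl _ _) (lexx _)))//.
have -> : g * `|emission_time v t - r| + `|emission_time v t - r|
   = (1 + g) * `|emission_time v t - r| by ring.
rewrite -mulrA ler_wpM2l// (le_trans eps)//.
by rewrite le_eqVlt; apply/orP; left; apply/eqP; ring.
Qed.

End stability.

(** * Euclidean geometry *)

Section euclidean.
Context (R : realType).
Implicit Types u v : 'rV[R]_3.

Lemma dotp_ge0 u : 0 <= dotp u u.
Proof. by apply: sumr_ge0 => i _; rewrite -expr2 sqr_ge0. Qed.

Lemma enorm_ge0 u : 0 <= enorm u.
Proof. exact: sqrtr_ge0. Qed.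

Lemma sqr_enorm u : enorm u ^+ 2 = dotp u u.
Proof. by rewrite sqr_sqrtr// dotp_ge0. Qed.

Lemma enorm_gt0 u : u != 0 -> 0 < enorm u.
Proof.
move=> u0; rewrite sqrtr_gt0 lt_neqAle dotp_ge0 andbT eq_sym.
apply: contra u0 => /eqP u0; apply/eqP/rowP => i; rewrite mxE.
move: u0 => /psumr_eq0P-/(_ (fun i _ => _))-/(_ _ i isT)/eqP.
by rewrite mulf_eq0 orbb => h; apply/eqP/h => j; rewrite -expr2 sqr_ge0.
Qed.

Lemma dotp_cauchy_schwarz u v : `|dotp u v| <= enorm u * enorm v.
Proof.
rewrite -ler_sqr ?nnegrE ?mulr_ge0 ?enorm_ge0//.
rewrite real_normK ?num_real// exprMn !sqr_enorm -subr_ge0.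
rewrite /dotp !big_ord_recl !big_ord0.
set u0 := u _ _; set u1 := u _ _; set u2 := u _ _.
set v0 := v _ _; set v1 := v _ _; set v2 := v _ _.
rewrite [leRHS](_ : _ = (u0 * v1 - u1 * v0) ^+ 2 + (u0 * v2 - u2 * v0) ^+ 2
   + (u1 * v2 - u2 * v1) ^+ 2); last by ring.
by rewrite !addr_ge0// sqr_ge0.
Qed.

(** This trades the Euclidean norm for coordinates, which are what the max norm and the
inverse matrix control. *)
Lemma enorm_le_sum u : enorm u <= \sum_(i < 3) `|u ord0 i|.
Proof.
rewrite -ler_sqr ?nnegrE ?enorm_ge0 ?sumr_ge0// sqr_enorm.
rewrite /dotp !big_ord_recl !big_ord0 !addr0 -!expr2.
rewrite -!(real_normK (num_real (u _ _))).
set a := `|_|; set b := `|_|; set d := `|_|.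
have [a0 b0 d0] : [/\ 0 <= a, 0 <= b & 0 <= d] by split; exact: normr_ge0.
rewrite -subr_ge0 [leRHS](_ : _ = 2 * (a * b) + 2 * (a * d) + 2 * (b * d));
  last by ring.
by rewrite !addr_ge0// mulr_ge0// mulr_ge0.
Qed.

End euclidean.

Lemma coord_cvg (R : realType) (S : Type) (F : set_system S) (f : S -> 'rV[R]_3)
    (u : 'rV[R]_3) (i : 'I_3) :
  f @ F --> u -> f x ord0 i @[x --> F] --> u ord0 i.
Proof.
move=> fu; apply: (@cvg_comp _ _ _ f (fun w : 'rV[R]_3 => w ord0 i) F (nbhs u)).
  exact: fu.
exact: coord_continuous.
Qed.

Lemma dotp_cvg (R : realType) (S : Type) (F : set_system S) (FF : Filter F)
    (f h : S -> 'rV[R]_3) (u v : 'rV[R]_3) :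
  f @ F --> u -> h @ F --> v -> dotp (f x) (h x) @[x --> F] --> dotp u v.
Proof.
move=> fu hv.
have coord i : f x ord0 i * h x ord0 i @[x --> F] --> u ord0 i * v ord0 i.
  by apply: cvgM; exact: coord_cvg.
under eq_fun do rewrite /dotp !big_ord_recl big_ord0.
rewrite /dotp !big_ord_recl big_ord0.
by do 3 (apply: cvgD; first exact: coord); exact: cvg_cst.
Qed.

Lemma enorm_cvg (R : realType) (S : Type) (F : set_system S) (FF : Filter F)
    (f : S -> 'rV[R]_3) (u : 'rV[R]_3) :
  f @ F --> u -> enorm (f x) @[x --> F] --> enorm u.
Proof.
move=> fu; apply: (@cvg_comp _ _ _ (fun x => dotp (f x) (f x)) Num.sqrt F
  (nbhs (dotp u u))); first exact: dotp_cvg.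
exact: sqrt_continuous.
Qed.

(** * Derivatives relative to an interval *)

Section one_sided_derivatives.
Context (R : realType).
Implicit Types (A : set R) (f : R -> 'rV[R]_3).

Lemma derivable_within_continuous_on A f :
  derivable_within A f -> {within A, continuous f}.
Proof.
move=> fD; apply/subspace_continuousP => t At.
have /cvg_ex[/= l fl] := fD t At.
have idt : (s - t) @[s --> within A t^'] --> (0 : R).
  rewrite -(subrr t); apply: cvgB; last exact: cvg_cst.
  apply: cvg_trans (@cvg_id _ (nbhs t)).
  move=> P; rewrite /within/= => tP.
  by apply: filterS tP => s Ps _ _.
have /cvgrPdist_lt h :
    (s - t) *: diffquot f t s @[s --> within A t^'] --> (0 : 'rV[R]_3).
  rewrite -(scale0r l).
  exact: cvgZ.
apply/cvgrPdist_lt => e e0.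
have {}h := h e e0.
have h2 : \forall s \near t, s != t -> A s -> `|0 - (s - t) *: diffquot f t s| < e.
  exact: h.
suff : \forall s \near t, A s -> `|f t - f s| < e by [].
near=> s => As.
have [->|st] := eqVneq s t; first by rewrite subrr normr0.
have : `|0 - (s - t) *: diffquot f t s| < e.
  by move: As st; near: s; apply: filterS h2 => s hs As st; exact: hs.
by rewrite sub0r normrN /diffquot scalerA divff ?subr_eq0// scale1r distrC.
Unshelve. all: by end_near. Qed.

Lemma is_derive_of_slope (f : R -> R) (t l : R) :
  (s - t)^-1 * (f s - f t) @[s --> t^'] --> l -> is_derive t 1 f l.
Proof.
move=> fl.
suff H : h^-1 *: (f (h *: 1 + t) - f t) @[h --> 0^'] --> l.
  by apply: DeriveDef; [apply/cvg_ex; exists l|exact: cvg_lim].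
apply/cvgrPdist_lt => e e0.
move/cvgrPdist_lt : fl => /(_ _ e0)/nbhs_ballP[d /= d0 hd].
apply/nbhs_ballP; exists d => //= h.
rewrite /ball/= sub0r normrN => hd' h0.
have := hd (h + t); rewrite /ball/= opprD addrCA subrr addr0 normrN.
move=> /(_ hd'); rewrite addrK -subr_eq0 addrK => /(_ h0).
by rewrite /GRing.scale/= mulr1.
Qed.

(** At an interior point of A, the filters of punctured neighbourhoods in A and
in R coincide. *)
Lemma derive_within_coord A f (t : R) (i : 'I_3) :
  derivable_within A f -> (interior A) t ->
  is_derive t 1 (fun s => f s ord0 i) (derive_within A f t ord0 i).
Proof.
move=> fD At; apply: is_derive_of_slope.
have fl : diffquot f t s @[s --> within A t^'] --> derive_within A f t.
  exact: fD (nbhs_singleton At).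
have : (diffquot f t s) ord0 i @[s --> within A t^'] -->
    derive_within A f t ord0 i.
  exact: (@coord_cvg _ _ _ (diffquot f t) _ i fl).
rewrite (_ : within A t^' = t^'); last first.
  apply/seteqP; split => P h.
    exact: (@filterS2 _ (nbhs t) _ A (fun s => s != t -> A s -> P s)
      (fun s => s != t -> P s) (fun s As Ps st => Ps st As) At h).
  exact: (@filterS _ (nbhs t) _ (fun s => s != t -> P s)
    (fun s => s != t -> A s -> P s) (fun s Ps st _ => Ps st) h).
rewrite (_ : (fun s => diffquot f t s ord0 i) =
  (fun s => (s - t)^-1 * (f s ord0 i - f t ord0 i)))//.
by apply/funext => s; rewrite !mxE.
Qed.

End one_sided_derivatives.

(** * Travel times of a trajectory *)

(** Freezing the source before time 0 agrees with [past_ext]; freezing it after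
time T as well makes the travel time total without changing its values on the
emissions observed. *)
Definition clamp (R : realType) (T r : R) : R := Num.max (Num.min r T) 0.

Definition delay (R : realType) (c T : R) (b : R -> 'rV[R]_3) (x : 'rV[R]_3)
  (r : R) : R := enorm (x - b (clamp T r)) / c.

Definition delay_rate (R : realType) (c T : R) (b : R -> 'rV[R]_3)
    (x : 'rV[R]_3) (r : R) : R :=
  - (dotp (velocity T b r) (x - b r) / enorm (x - b r)) / c.

Section clamp.
Context (R : realType) (T : R).
Hypothesis T_gt0 : 0 < T.

Lemma clamp_bounds r : 0 <= clamp T r <= T.
Proof.
by rewrite /clamp le_max lexx orbT/= ge_max ge_min lexx orbT/= ltW.
Qed.

Lemma clamp_id r : 0 <= r <= T -> clamp T r = r.
Proof. by move=> /andP[r0 rT]; rewrite /clamp min_l// max_l. Qed.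

Lemma clamp_past r : r <= T -> clamp T r = Num.max r 0.
Proof. by move=> rT; rewrite /clamp min_l. Qed.

Lemma clamp_lip r s : `|clamp T r - clamp T s| <= `|r - s|.
Proof.
have T0 := T_gt0.
wlog rs : r s / r <= s => [H|].
  by have [/H//|/ltW/H] := leP r s; rewrite distrC (distrC s).
rewrite distrC (distrC r) (ger0_norm (_ : 0 <= s - r)) ?subr_ge0//.
rewrite ler_norml /clamp; case: (leP r T); case: (leP s T) => ? ?;
  case: (leP T 0) => ?; case: (leP r 0) => ?; case: (leP s 0) => ?;
  by apply/andP; split; lra.
Qed.

End clamp.

Section trajectory.
Context (R : realType) (c c0 T T0 : R) (D : set 'rV[R]_3) (b : R -> 'rV[R]_3)
  (x : 'rV[R]_3).
Hypotheses (c_gt0 : 0 < c) (T_gt0 : 0 < T) (bP : trajectory c0 T D b)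
  (xD : forall y, D y -> 0 < enorm (x - y) <= c * T0).

Let b_diff : derivable_within `[0, T] b. Proof. by case: bP => -[]. Qed.

Lemma itv_interior r : 0 < r < T -> (interior (`[0, T] : set R)) r.
Proof.
move=> rT; have : r \in `]0, T[ by rewrite in_itv.
move/near_in_itvoo; rewrite /interior/=; apply: filterS => s.
by rewrite /= !in_itv/= => /andP[/ltW -> /ltW ->].
Qed.

Lemma velocity_continuous r : 0 < r < T -> {for r, continuous (velocity T b)}.
Proof.
move=> /itv_interior rT; have [[_ vD _] _ _] := bP.
have /subspace_continuousP := derivable_within_continuous_on vD.
by move=> /(_ r (nbhs_singleton rT)); rewrite (within_interior rT).
Qed.

Lemma trajectory_continuous r : 0 < r < T -> {for r, continuous b}.
Proof.
move=> /itv_interior rT.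
have /subspace_continuousP := derivable_within_continuous_on b_diff.
by move=> /(_ r (nbhs_singleton rT)); rewrite (within_interior rT).
Qed.

Lemma distance_pos r : 0 <= r <= T -> 0 < enorm (x - b r).
Proof. by have [_ bD _] := bP; move=> /bD/xD/andP[]. Qed.

Lemma distance_is_derive r : 0 < r < T ->
  is_derive r 1 (fun s => enorm (x - b s))
    (- (dotp (velocity T b r) (x - b r) / enorm (x - b r))).
Proof.
move=> rT; have d0 : 0 < enorm (x - b r).
  by apply: distance_pos; case/andP: rT => /ltW -> /ltW ->.
pose h (i : 'I_3) (s : R) := x ord0 i - b s ord0 i.
have hD i : is_derive r 1 (h i) (- velocity T b r ord0 i).
  have bD := derive_within_coord i b_diff (itv_interior rT).
  have := is_deriveB (is_derive_cst (x ord0 i) r 1) bD.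
  by rewrite sub0r.
have sqD : is_derive r 1 (fun s => dotp (x - b s) (x - b s))
    (- (2 * dotp (velocity T b r) (x - b r))).
  have := is_derive_sum (fun i => is_deriveX 2 (hD i)).
  rewrite (_ : \sum_(i < 3) h i ^+ 2 = fun s => dotp (x - b s) (x - b s)).
    move=> H; apply: is_derive_eq H _.
    rewrite /dotp mulr_sumr -sumrN; apply: eq_bigr => i _.
    by rewrite /h !mxE /GRing.scale/= expr1; ring.
  apply/funext => s; rewrite /dotp fct_sumE; apply: eq_bigr => i _.
  by rewrite /h !mxE exprfctE expr2.
have q0 : 0 < dotp (x - b r) (x - b r) by rewrite -sqr_enorm exprn_gt0.
have := is_derive1_comp (is_derive1_sqrt q0) sqD.
move=> H; apply: is_derive_eq H _.
by rewrite -/(enorm _); field; rewrite gt_eqF.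
Qed.

Lemma distance_rate_le r : 0 < r < T ->
  `|dotp (velocity T b r) (x - b r) / enorm (x - b r)| <= c0.
Proof.
move=> /andP[/ltW r0 /ltW rT]; have r0T : 0 <= r <= T by rewrite r0.
have d0 := distance_pos r0T; have [_ _ /(_ _ r0T) v0] := bP.
rewrite normrM normfV (gtr0_norm d0) ler_pdivrMr//.
by rewrite (le_trans (dotp_cauchy_schwarz _ _))// ler_wpM2r// ltW.
Qed.

(** The mean value theorem is applied to the distance itself, whose derivative is
bounded by the speed thanks to the Cauchy-Schwarz inequality. *)
Lemma distance_lip r s : 0 <= r <= T -> 0 <= s <= T ->
  `|enorm (x - b r) - enorm (x - b s)| <= c0 * `|r - s|.
Proof.
wlog rs : r s / r <= s => [H r0 s0|/andP[r0 rT] /andP[s0 sT]].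
  have [/H|/ltW/H] := leP r s; first exact.
  by rewrite distrC (distrC s); exact.
pose f y := enorm (x - b y).
pose df y := - (dotp (velocity T b y) (x - b y) / enorm (x - b y)).
have inside y : y \in `]r, s[ -> 0 < y < T.
  by rewrite in_itv/= => /andP[ry ys]; rewrite (le_lt_trans r0)//= (lt_le_trans ys).
have [rs_eq|rs_lt] := eqVneq r s.
  by rewrite rs_eq !subrr !normr0 mulr0.
have {}rs : r < s by rewrite lt_neqAle rs_lt.
have fC : {within `[r, s], continuous f}.
  apply: (@continuous_subspaceW _ _ _ `[0, T]).
    by apply: subset_itv; rewrite bnd_simp.
  apply/subspace_continuousP => y yT.
  have /subspace_continuousP/(_ y yT) by_ := derivable_within_continuous_on b_diff.
  by apply: enorm_cvg; apply: cvgB => //; exact: cvg_cst.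
have [y yrs E] := MVT rs (fun y yrs => distance_is_derive (inside y yrs)) fC.
rewrite distrC -/(f r) -/(f s) E normrM (distrC r) ler_wpM2r// normrN.
exact: distance_rate_le (inside y yrs).
Qed.

Lemma delay_is_derive r : 0 < r < T ->
  is_derive r 1 (delay c T b x) (delay_rate c T b x r).
Proof.
move=> rT.
have : is_derive r 1 (fun s => c^-1 *: (enorm (x - b s) : R^o))
    (delay_rate c T b x r).
  have := is_deriveZ c^-1 (distance_is_derive rT).
  by move=> H; apply: is_derive_eq H _; rewrite /delay_rate [RHS]mulrC.
apply: near_eq_is_derive.
have := itv_interior rT; rewrite /interior/=; apply: filterS => s.
rewrite /= in_itv/= => sT.
by rewrite /delay clamp_id// mulrC.
Qed.

Lemma delay_rate_continuous r : 0 < r < T ->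
  {for r, continuous (delay_rate c T b x)}.
Proof.
move=> rT; have bC := trajectory_continuous rT.
have vC := velocity_continuous rT.
have xbC : x - b s @[s --> r] --> x - b r.
  by apply: cvgB => //; exact: cvg_cst.
apply: cvgM; last exact: cvg_cst.
apply: cvgN; apply: cvgM; first exact: dotp_cvg.
apply: cvgV; last exact: enorm_cvg.
rewrite gt_eqF// distance_pos//.
by case/andP: rT => /ltW -> /ltW ->.
Qed.

(** Where the geometry enters: the detector stays away from the source, and the
speed bound makes the travel time (c0 / c)-Lipschitz. *)
Lemma trajectory_travel_delay :
  travel_delay (c0 / c) T0 T (delay c T b x) (delay_rate c T b x).
Proof.
have c0_ge0 : 0 <= c0.
  have [_ _ /(_ 0)] := bP; rewrite lexx ltW// => /(_ isT).
  by apply: le_trans; exact: enorm_ge0.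
split=> [r s|r|r rT|]; last exact: delay_rate_continuous.
- rewrite /delay -mulrBl normrM normfV (gtr0_norm c_gt0).
  rewrite [leRHS]mulrAC ler_pM2r ?invr_gt0//.
  apply: (le_trans (distance_lip (clamp_bounds T_gt0 r) (clamp_bounds T_gt0 s))).
  by rewrite ler_wpM2l// clamp_lip.
- have [_ /(_ _ (clamp_bounds T_gt0 r))/xD/andP[d0 dT] _] := bP.
  by rewrite /delay divr_gt0//= ler_pdivrMr// mulrC.
- split; first exact: delay_is_derive.
  rewrite /delay_rate normrM normrN normfV (gtr0_norm c_gt0).
  by rewrite ler_pM2r ?invr_gt0// distance_rate_le.
Qed.

(** An emission at a time r <= T satisfies the retarded-time equation at its
arrival time by construction, so the formula for the field applies there. *)
Lemma field_signal lambda phi : generated_field c lambda T b phi ->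
  signal (lambda / (4 * pi * c)) T (delay c T b x) (delay_rate c T b x) (phi x).
Proof.
move=> phiP.
have ret r : r <= T -> retarded_time c b x (r + delay c T b x r) r.
  by move=> rT; rewrite /retarded_time /delay clamp_past// addrK.
have off r : r <= T -> x != past_ext b r.
  move=> rT; rewrite /past_ext -(clamp_past rT) -subr_eq0.
  apply/eqP => xb; have := distance_pos (clamp_bounds T_gt0 r).
  by rewrite xb /enorm /dotp big1 ?sqrtr0 ?ltxx// => i _; rewrite mxE mul0r.
split=> [r r0|r /andP[r0 rT]].
  have rT : r <= T by rewrite ltW// (lt_trans r0).
  by rewrite (phiP _ _ _ rT (ret _ rT) (off _ rT)) /heaviside leNgt r0/= mul0r mulr0.
have rT' := ltW rT.
rewrite (phiP _ _ _ rT' (ret _ rT') (off _ rT')) /heaviside (ltW r0).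
rewrite /doppler /delay /delay_rate /past_ext clamp_id ?(ltW r0)//.
rewrite (max_l (ltW r0)).
set v := dotp _ _; set d := enorm _.
have d0 : d != 0 by rewrite gt_eqF// distance_pos// (ltW r0).
have c_neq0 : c != 0 by rewrite gt_eqF.
have pi_neq0 : pi != 0 :> R by rewrite gt_eqF// pi_gt0.
have -> : 1 + - (v / d) / c = 1 - v / (c * d) by field; rewrite d0 c_neq0.
rewrite mul1r !invfM; set h := (1 - _)^-1.
by move: pi pi_neq0 => p p_neq0; field; rewrite c_neq0 d0 p_neq0.
Qed.

End trajectory.

(** * Essential suprema *)

Lemma lebesgue_measureT_gt0 (R : realType) :
  (0 < @lebesgue_measure R [set: R])%E.
Proof.
by rewrite -set_itvNyy lebesgue_measure_itv/= ltey.
Qed.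

Lemma Linfty_le (R : realType) (S M : R) (f : R -> R) : 0 <= M ->
  (forall t, 0 < t < S -> `|f t| <= M) -> (Linfty S f <= M%:E)%E.
Proof.
move=> M0 fM; rewrite /Linfty unlock lebesgue_measureT_gt0.
apply/ess_supP; apply: (@filterS _ _
  (@ae_filter_ringOfSetsType _ _ _ (@lebesgue_measure R)) setT).
  move=> t _ /=; rewrite lee_fin patchE; case: ifPn => [|_]; last by rewrite normr0.
  by rewrite inE/= in_itv/=; exact: fM.
exact: (@filterT _ _ (@ae_filter_ringOfSetsType _ _ _ (@lebesgue_measure R))).
Qed.

Lemma Linfty_ae (R : realType) (S M : R) (f : R -> R) :
  (Linfty S f <= M%:E)%E ->
  {ae @lebesgue_measure R, forall t, 0 < t < S -> `|f t| <= M}.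
Proof.
rewrite /Linfty unlock lebesgue_measureT_gt0 => /ess_supP.
apply: ae_lebesgueS => t /=; rewrite lee_fin => + tS.
by rewrite patchE mem_set//= in_itv.
Qed.

(** * From distances to positions *)

Lemma coord_le_norm (R : realType) (v : 'rV[R]_3) (i : 'I_3) :
  `|v ord0 i| <= `|v|.
Proof.
rewrite [leRHS]/Num.norm/= mx_normrE.
exact: (le_bigmax _ (fun ij => `|v ij.1 ij.2|) (ord0, i)).
Qed.

Lemma boundary_coord_bounded (R : realType) (A : set 'rV[R]_3) :
  bounded_set A -> exists M, forall v i, closure A v -> `|v ord0 i| <= M.
Proof.
move=> [M0 [_ AM0]]; pose M := M0 + 1.
have AM w : A w -> `|w| <= M by move=> Aw; apply: AM0; rewrite // ltrDl.
exists (M + 1) => v i.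
move=> /(_ (ball v 1) (nbhsx_ballx _ _ ltr01))[w [Aw vw]].
have := AM _ Aw => /=; have := coord_le_norm w i.
have : `|v ord0 i - w ord0 i| <= 1 by case: vw => _ /(_ ord0 i); exact: ltW.
have : `|v ord0 i| <= `|v ord0 i - w ord0 i| + `|w ord0 i|.
  by rewrite -[in leLHS](subrK (w ord0 i) (v ord0 i)) ler_normD.
by lra.
Qed.

(** Boundedness of both sets makes the supremum finite; otherwise [sup] would be a
default value. *)
Lemma crossing_time_ge (R : realType) (c : R) (Omega D : set 'rV[R]_3) x y :
  0 < c -> bounded_set D -> bounded_set Omega -> boundary Omega x -> D y ->
  enorm (x - y) <= c * crossing_time c Omega D.
Proof.
move=> c0 /boundary_coord_bounded[M DM] /boundary_coord_bounded[N ON] xO yD.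
rewrite mulrC -ler_pdivrMr//; apply: ub_le_sup; last by exists x, y.
exists ((\sum_(i < 3) (N + M)) / c) => _ [x' [y' [[xO' _] yD' ->]]].
rewrite ler_pM2r ?invr_gt0// (le_trans (enorm_le_sum _))// ler_sum// => i _.
rewrite !mxE (le_trans (ler_normB _ _))// lerD ?ON ?DM//.
exact: subset_closure.
Qed.

(** The numbers bounded by B are the coordinates of X e, and e is X^-1 (X e). *)
Lemma enorm_le_inverse (R : realType) (X : 'M[R]_3) (e : 'rV[R]_3) (B : R) :
  X \in unitmx -> (forall k, `|dotp (row k X) e| <= B) ->
  enorm e <= (\sum_(j < 3) \sum_(k < 3) `|invmx X j k|) * B.
Proof.
move=> Xu XB; rewrite (le_trans (enorm_le_sum _))// mulr_suml ler_sum// => j _.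
have -> : e ord0 j = \sum_(k < 3) invmx X j k * dotp (row k X) e.
  transitivity ((invmx X *m (X *m e^T)) j ord0); first by rewrite mulKmx// mxE.
  rewrite mxE; apply: eq_bigr => k _; congr (_ * _).
  by rewrite mxE; apply: eq_bigr => l _; rewrite !mxE.
rewrite (le_trans (ler_norm_sum _ _ _))// mulr_suml ler_sum// => k _.
by rewrite normrM ler_wpM2l.
Qed.

(** The quadratic terms in u and v cancel between the two detectors. *)
Lemma dotp_polarization (R : realType) (x y u v : 'rV[R]_3) :
  2 * dotp (y - x) (u - v) =
  (enorm (x - u) ^+ 2 - enorm (x - v) ^+ 2)
  - (enorm (y - u) ^+ 2 - enorm (y - v) ^+ 2).
Proof.
rewrite !sqr_enorm /dotp -!sumrB mulr_sumr; apply: eq_bigr => i _.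
by rewrite !mxE; ring.
Qed.

Lemma sqr_diff_le (R : realType) (a b M d : R) :
  0 <= a <= M -> 0 <= b <= M -> `|a - b| <= d ->
  `|a ^+ 2 - b ^+ 2| <= 2 * M * d.
Proof.
move=> /andP[a0 aM] /andP[b0 bM] abd.
rewrite subr_sqr normrM mulrC ler_pM// ger0_norm ?addr_ge0//; lra.
Qed.

Lemma row_observation_le (R : realType) (x y u v : 'rV[R]_3) (M d : R) :
  enorm (x - u) <= M -> enorm (x - v) <= M ->
  enorm (y - u) <= M -> enorm (y - v) <= M ->
  `|enorm (x - u) - enorm (x - v)| <= d ->
  `|enorm (y - u) - enorm (y - v)| <= d ->
  `|dotp (y - x) (u - v)| <= 2 * M * d.
Proof.
move=> xu xv yu yv dx dy.
have := sqr_diff_le (_ : 0 <= enorm (x - u) <= M)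
  (_ : 0 <= enorm (x - v) <= M) dx.
rewrite !enorm_ge0 => /(_ xu xv).
have := sqr_diff_le (_ : 0 <= enorm (y - u) <= M)
  (_ : 0 <= enorm (y - v) <= M) dy.
rewrite !enorm_ge0 => /(_ yu yv).
have := dotp_polarization x y u v.
rewrite !ler_norml => E /andP[? ?] /andP[? ?]; apply/andP; split; lra.
Qed.

(** The bound of [delay_stability] with g = c0 / c and k = lambda / (4 pi c),
rescaled from times to distances. *)
Lemma distance_stability (R : realType) (c lambda c0 T : R)
    (D Omega : set 'rV[R]_3) (x : 'rV[R]_3) (b bt : R -> 'rV[R]_3)
    (phi phit : 'rV[R]_3 -> R -> R) (m : R) :
  let T0 := crossing_time c Omega D in
  0 < c -> 0 < lambda -> c0 < c -> 0 < T0 -> T0 < T ->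
  trajectory c0 T D b -> trajectory c0 T D bt ->
  (forall y, D y -> 0 < enorm (x - y) <= c * T0) ->
  generated_field c lambda T b phi -> generated_field c lambda T bt phit ->
  (Linfty (T + T0)%R (fun t => phit x t - phi x t)%R <= m%:E)%E ->
  forall r, 0 <= r <= T ->
  `|enorm (x - b r) - enorm (x - bt r)| <=
  c * ((1 + c0 / c) * (T0 * (T + T0) / (lambda / (4 * pi * c)))) * m.
Proof.
move=> T0 c_gt0 lambda_gt0 c0c T0_gt0 T0T bP btP xD fP ftP mis r rT.
have T_gt0 : 0 < T by exact: lt_trans T0T.
have c0_ge0 : 0 <= c0.
  have [_ _ /(_ r rT)] := bP; apply: le_trans; exact: enorm_ge0.
have k_gt0 : 0 < lambda / (4 * pi * c).
  by rewrite divr_gt0// !mulr_gt0// pi_gt0.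
have := delay_stability (divr_ge0 c0_ge0 (ltW c_gt0))
  (_ : c0 / c < 1) T0_gt0 T0T k_gt0
  (trajectory_travel_delay c_gt0 T_gt0 btP xD)
  (trajectory_travel_delay c_gt0 T_gt0 bP xD)
  (field_signal c_gt0 T_gt0 btP xD ftP)
  (field_signal c_gt0 T_gt0 bP xD fP) (Linfty_ae mis) rT.
rewrite ltr_pdivrMr// mul1r => /(_ c0c).
rewrite /delay clamp_id// -mulrBl normrM normfV (gtr0_norm c_gt0).
rewrite ler_pdivrMr// distrC => /le_trans; apply.
by rewrite le_eqVlt; apply/orP; left; apply/eqP; ring.
Qed.

Theorem theorem4p3 (R : realType) (c lambda c0 T : R)
    (D Omega : set 'rV[R]_3) (X : 'M[R]_3)
    (c_gt0 : 0 < c) (lambda_gt0 : 0 < lambda) (c0_lt_c : c0 < c)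
    (D_domain : domain D) (D_bounded : bounded_set D)
    (Omega_domain : domain Omega) (Omega_bounded : bounded_set Omega)
    (Omega_smooth : smooth_boundary Omega)
    (D_Omega : closure D `<=` Omega)
    (T_gt : crossing_time c Omega D < T)
    (X_inv : X \in unitmx) :
  exists C : R, 0 < C /\
    forall (x : nat -> 'rV[R]_3) (b bt : R -> 'rV[R]_3)
           (phi phit : 'rV[R]_3 -> R -> R),
      (forall i : nat, (1 <= i <= 6)%N -> boundary Omega (x i)) ->
      obs_matrix x = X ->
      trajectory c0 T D b -> trajectory c0 T D bt ->
      generated_field c lambda T b phi ->
      generated_field c lambda T bt phit ->
      let Tobs := T + crossing_time c Omega D in
      let misfit := fun i : nat =>
        Linfty Tobs (fun t : R => phit (x i) t - phi (x i) t) in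
      (Linfty T (fun t : R => enorm (b t - bt t)) <=
       C%:E * \big[Order.max/-oo]_(k < 3)
                (misfit (2 * k + 1)%N + misfit (2 * k + 2)%N))%E.
Proof.
set T0 := crossing_time c Omega D.
pose K := c * ((1 + c0 / c) * (T0 * (T + T0) / (lambda / (4 * pi * c)))).
(* 2 (c T0) comes from the difference of the squared distances. *)
pose C := (\sum_(j < 3) \sum_(k < 3) `|invmx X j k|) * (2 * (c * T0) * K).
(* Positivity is required even if no trajectory or detector exists, in which
   case the sign of C is unknown. *)
exists (`|C| + 1); split; first by rewrite ltr_wpDl.
move=> x b bt phi phit xO XE bP btP fP ftP.
have C_gt0 : 0 < `|C| + 1 by rewrite ltr_wpDl.
pose misfit i := Linfty (T + T0) (fun t : R => phit (x i) t - phi (x i) t).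
pose S := (\big[Order.max/-oo]_(k < 3)
  (misfit (2 * k + 1)%N + misfit (2 * k + 2)%N))%E.
suff : (Linfty T (fun t => enorm (b t - bt t)%R) <= (`|C| + 1)%:E * S)%E by [].
have misS i : (1 <= i <= 6)%N -> (misfit i <= S)%E.
  have pair (k : 'I_3) : (misfit (2 * k + 1)%N + misfit (2 * k + 2)%N <= S)%E.
    exact: (le_bigmax _ (fun k : 'I_3 =>
      (misfit (2 * k + 1)%N + misfit (2 * k + 2)%N)%E)).
  have mis0 j : (0 <= misfit j)%E by exact: Lnorm_ge0.
  move=> /andP[i1 i6].
  (* Detector i belongs to the pair of index (i - 1) / 2. *)
  have i2 : (i.-1./2 < 3)%N by move: i i1 i6; do 7?[case=> //].
  have [odd_i|even_i] := boolP (odd i).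
    apply: le_trans (pair (Ordinal i2)) => /=.
    have -> : (2 * i.-1./2 + 1)%N = i by move: i i1 i6 odd_i {i2}; do 7?[case=> //].
    by rewrite leeDl.
  apply: le_trans (pair (Ordinal i2)) => /=.
  have -> : (2 * i.-1./2 + 2)%N = i by move: i i1 i6 even_i {i2}; do 7?[case=> //].
  by rewrite leeDr.
have S0 : (0 <= S)%E by apply: le_trans (misS 1%N isT); exact: Lnorm_ge0.
(* An infinite misfit makes the right-hand side infinite. *)
have [Sfin|Sinf] := boolP (S \is a fin_num); last first.
  have -> : S = +oo%E by move: Sinf S0; case: (S).
  by rewrite gt0_muley ?leey// lte_fin.
pose s := fine S.
have SE : S = s%:E by rewrite fineK.
have s0 : 0 <= s by rewrite -lee_fin -SE.
have off i y : (1 <= i <= 6)%N -> D y -> 0 < enorm (x i - y) <= c * T0.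
  move=> /xO xi Dy; rewrite crossing_time_ge// andbT enorm_gt0// subr_eq0.
  apply/eqP => xy; have [_ []] := xi; rewrite xy.
  have [oO _ _] := Omega_domain; apply: open_nbhs_nbhs; split => //.
  by apply: D_Omega; exact: subset_closure.
have T0_gt0 : 0 < T0.
  have [_ _ [y Dy]] := D_domain; have /andP[d0 dT] := off 1%N y isT Dy.
  by rewrite -(pmulr_rgt0 _ c_gt0) (lt_le_trans d0).
have dist i : (1 <= i <= 6)%N -> forall r, 0 <= r <= T ->
    `|enorm (x i - b r) - enorm (x i - bt r)| <= K * s.
  move=> i6; have mis : (misfit i <= s%:E)%E by rewrite -SE; exact: misS.
  exact: (distance_stability c_gt0 lambda_gt0 c0_lt_c T0_gt0 T_gt bP btP
    (fun y => @off i y i6) fP ftP mis).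
have T_gt0 : 0 < T by exact: lt_trans T_gt.
rewrite SE -EFinM; apply: Linfty_le; first by rewrite mulr_ge0// ltW.
move=> t /andP[/ltW t0 /ltW tT]; have t0T : 0 <= t <= T by rewrite t0.
have [[_ /(_ t t0T) Db _] [_ /(_ t t0T) Dbt _]] := (bP, btP).
rewrite ger0_norm ?enorm_ge0//.
apply: (@le_trans _ _ (C * s)); last first.
  by rewrite ler_wpM2r// (le_trans (ler_norm _))// lerDl.
rewrite /C -(mulrA _ _ s) -(mulrA _ K s); apply: enorm_le_inverse => // k.
rewrite -XE rowK.
have [k1 k2] : (1 <= 2 * k + 1 <= 6)%N /\ (1 <= 2 * k + 2 <= 6)%N.
  by case: k => -[|[|[|]]].
have near y z : (1 <= y <= 6)%N -> D z -> enorm (x y - z) <= c * T0.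
  by move=> y6 Dz; have /andP[] := off y z y6 Dz.
exact: (row_observation_le (near _ _ k1 Db) (near _ _ k1 Dbt)
  (near _ _ k2 Db) (near _ _ k2 Dbt) (dist _ k1 _ t0T) (dist _ k2 _ t0T)).
Qed.
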